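(* Let $$L=(k+2)\sigma^2+(-6k-9)\sigma+(k+1),$$ and let $n$ be a positive integer. Then for any polynomial $p(k)\in\mathbb{Z}[k]$, $$\sum_{k=0}^{n-1} L^{\ast}(p(k))D_k \equiv 0 \pmod{n},$$ where $L^{\ast}$ is the adjoint of $L$.
   Context: The central Delannoy numbers are $D_k=\sum_{i=0}^{k}\binom{k}{i}\binom{k+i}{i}$ for $k\ge 0$. $\sigma$ is the shift operator in $k$ ($\sigma F(k)=F(k+1)$). The adjoint of an operator $L=\sum_{i=0}^{J}a_i(k)\sigma^i$ with polynomial coefficients is $L^{\ast}=\sum_{i=0}^{J}\sigma^{-i}a_i(k)$, so that $L^{\ast}(p(k))=\sum_{i=0}^{J}a_i(k-i)p(k-i)$ for a polynomial $p(k)$. *)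

(* Defs.v *)
From mathcomp Require Import all_boot all_order all_algebra.

Set Implicit Arguments.
Unset Strict Implicit.
Unset Printing Implicit Defensive.

Import GRing.Theory.
Local Open Scope ring_scope.

Definition delannoy (k : nat) : nat :=
  (\sum_(0 <= i < k.+1) 'C(k, i) * 'C(k + i, i))%N.

(* The action of sigma^(-i) on a polynomial: p(k) |-> p(k - i). *)
Definition shift_back (R : comNzRingType) (i : nat) (p : {poly R}) : {poly R} :=
  p \Po ('X - i%:R%:P).

(* A recurrence operator a_0(k) + a_1(k) sigma + ... + a_J(k) sigma^J is encoded
   by the list [:: a_0; a_1; ...; a_J] of its coefficients, in which 'X plays
   the role of k; its adjoint is the sum of the sigma^(-i) a_i(k). *)
Definition adjoint (R : comNzRingType) (L : seq {poly R}) (p : {poly R}) :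
    {poly R} :=
  \sum_(0 <= i < size L) shift_back i (L`_i * p).

(* (k + 2) sigma^2 + (-6k - 9) sigma + (k + 1), lowest order first. *)
Definition delannoy_op : seq {poly int} :=
  [:: 'X + 1; - 6%:R *: 'X - 9%:R%:P; 'X + 2%:R%:P].

(* Main.v *)
Require Import Defs.
From mathcomp Require Import all_boot all_order all_algebra.
From mathcomp Require Import zify ring.

Set Implicit Arguments.
Unset Strict Implicit.
Unset Printing Implicit Defensive.

Import GRing.Theory.
Local Open Scope ring_scope.

(** The Delannoy numbers are annihilated by L, so L^*(p)(k) D_k is a difference
    T(k+1) - T(k), where T(k) = k (p(k-1) D_(k-1) - p(k-2) D_k); the sum
    telescopes to T(n), a multiple of n.  The recurrence L D = 0 is the value at
    x = 1 of Bonnet's recurrence for the Legendre polynomials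
    P_k(1 + 2x) = \sum_i 'C(k, i) 'C(k + i, i) x^i, proved coefficientwise. *)

Lemma ffactnD (n m p : nat) : (n ^_ (m + p) = n ^_ m * (n - m) ^_ p)%N.
Proof.
elim: m n => [|m IHm] [|n]; rewrite ?add0n ?ffactn0 ?subn0 ?mul1n ?addSn //.
by rewrite !ffactSS IHm mulnA subSS.
Qed.

Definition legendre_coef (k i : nat) : nat := ('C(k, i) * 'C(k + i, i))%N.

(** Splitting the falling factorial in the middle gives [(k + i) ^_ i] times [k ^_ i]. With no
    division, it also covers [i > k], where both sides vanish. *)
Lemma legendre_coef_ffact (k i : nat) :
  (legendre_coef k i * (i`! * i`!) = (k + i) ^_ (i + i))%N.
Proof.
by rewrite ffactnD addnK -!bin_ffact /legendre_coef mulnACA mulnC.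
Qed.

(** This is the coefficient of x^(j+1) in Bonnet's recurrence at 1 + 2x. Multiplied by (j+1)!^2,
    each term becomes a multiple of [A = (k.+1 + j) ^_ (j + j)]. *)
Lemma legendre_coef_Bonnet (k j : nat) :
  (k.+2 * legendre_coef k.+2 j.+1 + k.+1 * legendre_coef k j.+1
    = (2 * k + 3) * (legendre_coef k.+1 j.+1 + 2 * legendre_coef k.+1 j))%N.
Proof.
have fact2_gt0 : (0 < j.+1`! * j.+1`!)%N by rewrite muln_gt0 fact_gt0.
apply/eqP; rewrite -(eqn_pmul2r fact2_gt0); apply/eqP.
have := legendre_coef_ffact k.+1 j.
have := legendre_coef_ffact k.+1 j.+1.
have := legendre_coef_ffact k j.+1.
have := legendre_coef_ffact k.+2 j.+1.
have -> : (k.+2 + j.+1 = (k.+1 + j).+2)%N by lia.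
have -> : (k + j.+1 = k.+1 + j)%N by lia.
have -> : (k.+1 + j.+1 = (k.+1 + j).+1)%N by lia.
have -> : (j.+1 + j.+1 = (j + j).+2)%N by lia.
rewrite ffactSS ffactSS ffactSS !ffactnSr factS.
(* If k + 1 < j, the common falling factorial is 0, and so is every term. *)
have [lt_kj|le_jk] := ltnP k.+1 j.
  rewrite ffact_small; last by lia.
  move: (legendre_coef _ _) (legendre_coef _ _) (legendre_coef _ _) => a b c.
  nia.
move: (_ ^_ _) => A.
have -> : (k.+1 + j - (j + j) = k.+1 - j)%N by lia.
have -> : (k.+1 + j - (j + j).+1 = k - j)%N by lia.
move: (legendre_coef k.+2 _) (legendre_coef k _) (legendre_coef k.+1 j.+1)
  (legendre_coef k.+1 j) => a b c d Ha Hb Hc Hd.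
rewrite mulnDl -[(k.+2 * a * _)%N]mulnA -[(k.+1 * b * _)%N]mulnA Ha Hb.
rewrite -[RHS]mulnA (mulnDl c) Hc.
have -> : (2 * d * (j.+1 * j`! * (j.+1 * j`!)) = 2 * j.+1 ^ 2 * A)%N.
  by rewrite -Hd; ring.
(* At j = k + 1 the truncated [k - j] is 0 rather than -1, but the factor [k.+1 - j] is 0 as
   well. *)
case: (ltngtP j k.+1) le_jk => // [lt_jk _|-> _].
  have -> : k = (j + (k - j))%N by lia.
  move: (k - j)%N => m.
  have -> : ((j + m).+1 - j = m.+1)%N by lia.
  have -> : (j + m - j = m)%N by lia.
  ring.
rewrite subnn; ring.
Qed.

Lemma delannoy_widen (k N : nat) : (k < N)%N ->
  delannoy k = (\sum_(0 <= i < N) legendre_coef k i)%N.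
Proof.
move=> lt_kN; rewrite (big_cat_nat (n := k.+1)) //=.
rewrite [X in (_ + X)%N]big_nat_cond [X in (_ + X)%N]big1 ?addn0 //.
by move=> i /andP[/andP[lt_ki _] _]; rewrite /legendre_coef bin_small.
Qed.

Lemma delannoy_rec (k : nat) :
  (k.+2 * delannoy k.+2 + k.+1 * delannoy k = (6 * k + 9) * delannoy k.+1)%N.
Proof.
have -> : ((6 * k + 9) * delannoy k.+1
  = (2 * k + 3) * (delannoy k.+1 + 2 * delannoy k.+1))%N by ring.
(* The sum coming from the 2x term gets one summand fewer: once the others lose their constant term,
   all run over the same j. *)
rewrite [in X in (_ + X)%N](@delannoy_widen k k.+3); last by lia.
rewrite (@delannoy_widen k.+2 k.+3) // {1}(@delannoy_widen k.+1 k.+3) //.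
rewrite (@delannoy_widen k.+1 k.+2) // !(big_nat_recl k.+2) //.
rewrite !mulnDr addnACA 2!big_distrr -big_split /=.
under eq_bigr do rewrite legendre_coef_Bonnet.
rewrite -big_distrr big_split -big_distrr /legendre_coef !bin0 /=.
ring.
Qed.

Lemma adjoint_delannoy_op (p : {poly int}) (x : int) :
  (adjoint delannoy_op p).[x]
    = (x + 1) * p.[x] - (6 * x + 3) * p.[x - 1] + x * p.[x - 2].
Proof.
rewrite /adjoint unlock /= /shift_back !hornerE !horner_comp !hornerE /=.
ring.
Qed.

Lemma sum_adjoint_delannoy (n : nat) (p : {poly int}) :
  \sum_(0 <= k < n) (adjoint delannoy_op p).[k%:Z] * (delannoy k)%:Z
    = n%:Z * (p.[n%:Z - 1] * (delannoy n.-1)%:Z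
              - p.[n%:Z - 2] * (delannoy n)%:Z).
Proof.
elim: n => [|n IHn]; first by rewrite big_nil mul0r.
rewrite big_nat_recr //= IHn adjoint_delannoy_op.
have -> : n.+1%:Z - 1 = n%:Z by lia.
have -> : n.+1%:Z - 2 = n%:Z - 1 by lia.
have rec : (n%:Z + 1) * (delannoy n.+1)%:Z
    = (6 * n%:Z + 3) * (delannoy n)%:Z - n%:Z * (delannoy n.-1)%:Z.
  (* At n = 0 the junk value [0.-1 = 0] is multiplied by 0, leaving D_1 = 3 D_0. *)
  case: n {IHn} => [|n]; first by rewrite /delannoy unlock.
  by have /= := delannoy_rec n; lia.
have -> : n.+1%:Z = n%:Z + 1 by lia.
rewrite [RHS]mulrBr mulrCA [(_ + 1) * (p.[n%:Z - 1] * _)]mulrCA rec.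
ring.
Qed.

Theorem corollary9 (n : nat) (hn : (0 < n)%N) (p : {poly int}) :
  (\sum_(0 <= k < n) (adjoint delannoy_op p).[k%:Z] * (delannoy k)%:Z
     = 0 %[mod n%:Z])%Z.
Proof. by rewrite sum_adjoint_delannoy modzMr mod0z. Qed.
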